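(* Let $\mathbf{A}\in\mathbb{H}^{n\times n}$ be a Hermitian quaternion matrix with $\mathrm{Ind}\,\mathbf{A}=k$ and $\operatorname{rank}\mathbf{A}^{k+1}=\operatorname{rank}\mathbf{A}^{k}=r\le n$ (with $r\ge 1$), and let $\mathbf{B}\in\mathbb{H}^{m\times n}$. Put $\check{\mathbf{B}}=\mathbf{B}\mathbf{A}^{k}\in\mathbb{H}^{m\times n}$, with $i$th row $\check{\mathbf{b}}_{i.}$. Then for the Drazin inverse solution $\mathbf{X}=\mathbf{B}\mathbf{A}^{D}=(x_{ij})\in\mathbb{H}^{m\times n}$ of the matrix equation $\mathbf{X}\mathbf{A}=\mathbf{B}$ we have, for all $i=1,\dots,m$ and $j=1,\dots,n$, $$x_{ij}=\frac{\sum_{\alpha\in I_{r,n}\{j\}}\mathrm{rdet}_{j}\left(\left(\mathbf{A}^{k+1}\right)_{j.}\left(\check{\mathbf{b}}_{i.}\right)\right)_{\alpha}^{\alpha}}{\sum_{\alpha\in I_{r,n}}\left|\left(\mathbf{A}^{k+1}\right)_{\alpha}^{\alpha}\right|}.$$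
   Context: $\mathbb{H}$ is the skew field of real quaternions; $\mathbf{A}^{*}$ is the conjugate transpose and $\mathbf{A}$ is Hermitian if $\mathbf{A}^*=\mathbf{A}$. The rank of a quaternion matrix is the maximal number of right-linearly independent columns (equivalently, of left-linearly independent rows). Index and Drazin inverse: $\mathrm{Ind}\,\mathbf{A}$ is the least integer $k\ge 0$ with $\operatorname{rank}\mathbf{A}^{k+1}=\operatorname{rank}\mathbf{A}^{k}$ ($\mathbf{A}^0=\mathbf{I}$). For $k=\mathrm{Ind}\,\mathbf{A}$, the Drazin inverse $\mathbf{A}^D$ is the unique matrix $\mathbf{X}$ with $\mathbf{A}^{k+1}\mathbf{X}=\mathbf{A}^{k}$, $\mathbf{X}\mathbf{A}\mathbf{X}=\mathbf{X}$, $\mathbf{A}\mathbf{X}=\mathbf{X}\mathbf{A}$. The ''Drazin inverse solution'' of $\mathbf{X}\mathbf{A}=\mathbf{B}$ is by definition the matrix $\mathbf{B}\mathbf{A}^D$. Row determinants of $\mathbf{M}=(m_{pq})\in\mathbb{H}^{n\times n}$: given $i$, write each permutation $\sigma\in S_n$ as a product of disjoint cycles (including cycles of length one) $C_1C_2\cdots C_r$, where $C_1$ is the cycle containing $i$ and is written starting with $i$, each $C_t$ with $t\ge2$ is written starting with its smallest element, and the first elements of $C_2,\dots,C_r$ are increasing. For a cycle $C=(c_0\,c_1\dots c_l)$ set $m_C=m_{c_0c_1}m_{c_1c_2}\cdots m_{c_lc_0}$. Then $\mathrm{rdet}_i\mathbf{M}=\sum_{\sigma\in S_n}(-1)^{n-r}m_{C_1}m_{C_2}\cdots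 m_{C_r}$, where $r=r(\sigma)$ is the number of cycles. For a Hermitian matrix all row determinants coincide and are real; their common value is the determinant $\det\mathbf{M}=|\mathbf{M}|$. Notation: $\mathbf{M}_{j.}(\mathbf{b})$ is $\mathbf{M}$ with its $j$th row replaced by the row $\mathbf{b}$. $\mathbf{M}_\alpha^\alpha$ is the principal submatrix with rows and columns indexed by $\alpha$; its rows and columns keep their original labels, so $\mathrm{rdet}_j(\mathbf{M}_\alpha^\alpha)$ ($j\in\alpha$) refers to the row originally labelled $j$. For $1\le s\le n$, $I_{s,n}$ is the set of all strictly increasing sequences (subsets) of $s$ integers from $\{1,\dots,n\}$, and $I_{s,n}\{j\}$ is the subset of those containing $j$. *)

(* Defs.v *)
From HB Require Import structures.
From mathcomp Require Import all_boot all_order all_algebra all_fingroup.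
From mathcomp Require Import boolp classical_sets reals.
From mathcomp Require Import ring.

Set Implicit Arguments.
Unset Strict Implicit.
Unset Printing Implicit Defensive.

Import Order.TTheory GRing.Theory Num.Theory.
Local Open Scope ring_scope.

Record quat (R : realType) := Quat { qr : R; qi : R; qj : R; qk : R }.

Section Quaternion.
Variable R : realType.
Local Notation H := (quat R).
Implicit Types x y z : H.

Definition quat_to_tuple x : R * R * R * R := (qr x, qi x, qj x, qk x).
Definition quat_of_tuple (t : R * R * R * R) : H :=
  let: (a, b, c, d) := t in Quat a b c d.
Lemma quat_to_tupleK : cancel quat_to_tuple quat_of_tuple.
Proof. by case. Qed.

HB.instance Definition _ := Choice.copy H (can_type quat_to_tupleK).

Definition addq x y : H :=
  Quat (qr x + qr y) (qi x + qi y) (qj x + qj y) (qk x + qk y).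
Definition oppq x : H := Quat (- qr x) (- qi x) (- qj x) (- qk x).
Definition mulq x y : H :=
  Quat (qr x * qr y - qi x * qi y - qj x * qj y - qk x * qk y)
       (qr x * qi y + qi x * qr y + qj x * qk y - qk x * qj y)
       (qr x * qj y - qi x * qk y + qj x * qr y + qk x * qi y)
       (qr x * qk y + qi x * qj y - qj x * qi y + qk x * qr y).

Definition quat_of_real (a : R) : H := Quat a 0 0 0.
Definition conjq x : H := Quat (qr x) (- qi x) (- qj x) (- qk x).
Definition normsqq x : R := qr x ^+ 2 + qi x ^+ 2 + qj x ^+ 2 + qk x ^+ 2.
Definition invq x : H := mulq (quat_of_real (normsqq x)^-1) (conjq x).

Lemma addqA : associative addq.
Proof. by move=> [????] [????] [????]; rewrite /addq /= !addrA. Qed.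
Lemma addqC : commutative addq.
Proof. by move=> [????] [????]; rewrite /addq /=; congr Quat; rewrite addrC. Qed.
Lemma add0q : left_id (quat_of_real 0) addq.
Proof. by move=> [????]; rewrite /addq /= !add0r. Qed.
Lemma addNq : left_inverse (quat_of_real 0) oppq addq.
Proof. by move=> [????]; rewrite /addq /oppq /= !addNr. Qed.

HB.instance Definition _ := GRing.isZmodule.Build H addqA addqC add0q addNq.

Lemma mulqA : associative mulq.
Proof. by move=> [????] [????] [????]; rewrite /mulq /=; congr Quat; ring. Qed.
Lemma mul1q : left_id (quat_of_real 1) mulq.
Proof. by move=> [????]; rewrite /mulq /=; congr Quat; ring. Qed.
Lemma mulq1 : right_id (quat_of_real 1) mulq.
Proof. by move=> [????]; rewrite /mulq /=; congr Quat; ring. Qed.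
Lemma mulqDl : left_distributive mulq addq.
Proof. by move=> [????] [????] [????]; rewrite /mulq /addq /=; congr Quat; ring. Qed.
Lemma mulqDr : right_distributive mulq addq.
Proof. by move=> [????] [????] [????]; rewrite /mulq /addq /=; congr Quat; ring. Qed.
Lemma oneq_neq0 : quat_of_real 1 != 0 :> H.
Proof. by apply/eqP => -[] /eqP; rewrite oner_eq0. Qed.

HB.instance Definition _ :=
  GRing.Zmodule_isNzRing.Build H mulqA mul1q mulq1 mulqDl mulqDr oneq_neq0.

Lemma normsqq_eq0 x : (normsqq x == 0) = (x == 0).
Proof.
case: x => a b c d; rewrite /normsqq /=.
rewrite !paddr_eq0 ?addr_ge0 ?sqr_ge0 // !sqrf_eq0.
apply/idP/eqP => [|[-> -> -> ->]]; last by rewrite eqxx.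
by case/andP=> /andP[/andP[/eqP-> /eqP->] /eqP->] /eqP->.
Qed.

Lemma mulVq : {in [pred x | x != 0], left_inverse 1 invq *%R}.
Proof.
move=> x; rewrite inE -normsqq_eq0 => nz.
transitivity (quat_of_real ((normsqq x)^-1 * normsqq x)); last by rewrite mulVf.
change (mulq (invq x) x = quat_of_real ((normsqq x)^-1 * normsqq x)).
rewrite /invq; move: (normsqq x)^-1 => v {nz}; case: x => a b c d.
by rewrite /quat_of_real /normsqq /mulq /=; congr Quat; ring.
Qed.

Lemma mulqV : {in [pred x | x != 0], right_inverse 1 invq *%R}.
Proof.
move=> x; rewrite inE -normsqq_eq0 => nz.
transitivity (quat_of_real ((normsqq x)^-1 * normsqq x)); last by rewrite mulVf.
change (mulq x (invq x) = quat_of_real ((normsqq x)^-1 * normsqq x)).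
rewrite /invq; move: (normsqq x)^-1 => v {nz}; case: x => a b c d.
by rewrite /quat_of_real /normsqq /mulq /=; congr Quat; ring.
Qed.

Lemma unitqP x y : y * x = 1 /\ x * y = 1 -> x != 0.
Proof. by case=> yx _; apply: contra_eq_neq yx => ->; rewrite mulr0 eq_sym oner_eq0. Qed.

Lemma invq_out : {in [predC [pred x | x != 0]], invq =1 id}.
Proof.
move=> x; rewrite !inE negbK => /eqP->; rewrite /invq /mulq /=.
by congr Quat; rewrite /=; ring.
Qed.

HB.instance Definition _ :=
  GRing.NzRing_hasMulInverse.Build H mulVq mulqV unitqP invq_out.

End Quaternion.

Section QuaternionMatrix.
Variable R : realType.
Local Notation H := (quat R).

Definition ctransmx m n (A : 'M[H]_(m, n)) : 'M[H]_(n, m) :=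
  (map_mx (@conjq R) A)^T.

Definition qhermitian n (A : 'M[H]_n) : Prop := ctransmx A = A.

(* The entries of [A *m c] are the [\sum_j A i j * c j 0]: the scalars act on
   the columns of A from the right. *)
Definition rfree_cols m n (A : 'M[H]_(m, n)) (S : {set 'I_n}) : Prop :=
  forall c : 'cV[H]_n,
    (forall j, j \notin S -> c j 0 = 0) -> A *m c = 0 -> c = 0.

Definition qrank m n (A : 'M[H]_(m, n)) : nat :=
  \max_(S : {set 'I_n} | `[< rfree_cols A S >]) #|S|.

Lemma qrank_exprS n (A : 'M[H]_n) k : (qrank (A ^+ k.+1) <= qrank (A ^+ k))%N.
Proof.
apply/bigmax_leqP => S /asboolP freeS.
apply: (leq_bigmax_cond (F := fun S : {set 'I_n} => #|S|)); apply/asboolP => c c0 Ac0.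
apply: freeS => //.
by rewrite exprS -[A * _]/(A *m _) -mulmxA Ac0 mulmx0.
Qed.

Lemma ex_index n (A : 'M[H]_n) :
  exists k, qrank (A ^+ k.+1) == qrank (A ^+ k).
Proof.
apply: contrapT => noidx.
suff lt k : (qrank (A ^+ k) + k <= qrank (A ^+ 0))%N.
  by have := lt (qrank (A ^+ 0)).+1; rewrite addnS ltnNge leq_addl.
elim: k => [|k IHk]; first by rewrite addn0.
rewrite addnS -addSn; apply: leq_trans IHk; rewrite leq_add2r ltn_neqAle.
rewrite qrank_exprS andbT; apply/negP => e; apply: noidx; by exists k.
Qed.

Definition mxind n (A : 'M[H]_n) : nat := ex_minn (ex_index A).

Definition is_drazin n (A X : 'M[H]_n) : Prop :=
  [/\ A ^+ (mxind A).+1 *m X = A ^+ mxind A,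
      X *m A *m X = X
    & A *m X = X *m A].

(* There is exactly one X with [is_drazin A X]; the default 0 is never used. *)
Definition drazin n (A : 'M[H]_n) : 'M[H]_n :=
  xget 0 [set X | is_drazin A X]%classic.

Definition row_repl n (M : 'M[H]_n) (j : 'I_n) (b : 'rV[H]_n) : 'M[H]_n :=
  \matrix_(p, q) if p == j then b 0 q else M p q.

(* m_{c0 c1} m_{c1 c2} ... m_{cl c0} for the cycle (c0 c1 ... cl) of s, where
   c_t = s^t c0.  The product is noncommutative, in increasing order of t. *)
Definition cycle_prod n (M : 'M[H]_n) (s : {perm 'I_n}) (c0 : 'I_n) : H :=
  \prod_(t < #|porbit s c0|) M ((s ^+ t)%g c0) ((s ^+ t.+1)%g c0).

(* First elements of the cycles of s (a permutation of [a]), in the order in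
   which the cycles are multiplied: first i, then the least elements of the
   cycles avoiding i, increasingly since [enum 'I_n] is increasing. *)
Definition cycle_heads n (a : {set 'I_n}) (s : {perm 'I_n}) (i : 'I_n) :
    seq 'I_n :=
  i :: [seq c <- enum 'I_n | [&& c \in a, c \notin porbit s i
                             & [forall d in porbit s c, (c <= d)%N]]].

(* Row determinant of the principal submatrix of M indexed by [a], keeping the
   original labels; it is meant for i \in a.  The permutations of [a] are the
   permutations of 'I_n fixing the complement of [a] pointwise, and only their
   cycles inside [a] are counted.  For [a = [set: 'I_n]] this is the row
   determinant of M itself. *)
Definition rdet n (a : {set 'I_n}) (i : 'I_n) (M : 'M[H]_n) : H :=
  \sum_(s : {perm 'I_n} | perm_on a s)
    (-1) ^+ (#|a| - size (cycle_heads a s i)) *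
    \prod_(c <- cycle_heads a s i) cycle_prod M s c.

(* The common, real value of all row determinants of the principal submatrix
   of M indexed by [a]; it is meant for M Hermitian and [a] nonempty. *)
Definition hdet n (a : {set 'I_n}) (M : 'M[H]_n) : R :=
  xget 0 [set d : R | forall i, i \in a -> rdet a i M = quat_of_real d]%classic.

End QuaternionMatrix.

(* Main.v *)
(* Write M = A^(k+1) and let d_s be the sum of the principal minors of M of
   order s.  Following a cycle through j step by step writes a row determinant
   as a sum over disjoint paths; for Hermitian M, reversing a closed path
   conjugates its weight, so the minors D(a) are real and independent of the
   distinguished row, and the minors with a repeated row vanish.  Hence the
   matrices R_s whose (c,j) entry is the coefficient of b_c in
     \sum_(a of size s+1 containing j) rdet_j (M_{j.}(b))_a^a
   satisfy the Faddeev-LeVerrier recursion R_0 = I, M R_s + R_{s+1} = d_{s+1} I.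
   As R_n = 0, and d_s = 0 for s > r = rank M, descending induction gives
   M R_r = 0, hence A^k R_r = 0, so that A^D = d_r^-1 A^k R_{r-1} as soon as
   d_r <> 0.  A Hermitian matrix has index at most 1: for k = 0, d_r = det M
   is nonzero because tr R_s = (n-s) d_s, and for k = 1, M = A^* A has
   nonnegative principal minors, one of which is positive. *)
From HB Require Import structures.
Require Import Defs.
From mathcomp Require Import all_boot all_order all_algebra all_fingroup.
From mathcomp Require Import boolp reals.

From mathcomp Require Import ring.
Set Implicit Arguments.
Unset Strict Implicit.
Unset Printing Implicit Defensive.

From mathcomp Require classical_sets.

Import Order.TTheory GRing.Theory Num.Theory.
Local Open Scope ring_scope.

Lemma porbit_iter_neq (T : finType) (s : {perm T}) j t :
  (0 < t < #|porbit s j|)%N -> (s ^+ t)%g j != j.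
Proof.
case/andP => t0 tlt; have := uniq_traject_porbit s j.
move/(nth_uniq j (i := t) (j := 0)); rewrite size_traject tlt.
rewrite (leq_ltn_trans _ tlt) // => /(_ isT isT).
rewrite !nth_traject ?(leq_ltn_trans _ tlt) //= permX => ->.
by rewrite -lt0n.
Qed.

(** * Row determinants: contracting one step of a cycle *)

(* [tperm j c * s], for s fixing c, inserts c just after j in its cycle. *)
Section Contraction.
Variables (T : finType) (j c : T) (s : {perm T}).
Hypotheses (neq_cj : c != j) (sc : s c = c).
Local Notation s' := (tperm j c * s)%g.

Lemma contractE x : x != j -> x != c -> s' x = s x.
Proof. by move=> xj xc; rewrite permM tpermD // eq_sym. Qed.

Lemma contract_l : s' j = c.
Proof. by rewrite permM tpermL. Qed.

Lemma contract_r : s' c = s j.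
Proof. by rewrite permM tpermR. Qed.

Lemma notin_porbit_fixed x : x != c -> c \notin porbit s x.
Proof.
move=> xc; rewrite porbit_sym; apply/porbitP => -[t xE]; case/eqP: xc.
by rewrite xE permX iter_fix.
Qed.

(** Each inclusion holds because its target is stable under the permutation generating the included
    orbit: [s] and [s'] differ only at [j] and [c], and [s' c] is [s j]. *)
Lemma porbit_contract : porbit s' j = c |: porbit s j.
Proof.
have stable (u : {perm T}) (S : {set T}) x :
    (forall y, y \in S -> u y \in S) -> x \in S -> porbit u x \subset S.
  move=> uS Sx; apply/subsetP => y /porbitP[t ->].
  by elim: t => [|t IHt]; rewrite ?perm1 // expgSr permM uS.
have step (u : {perm T}) x y : y \in porbit u x -> u y \in porbit u x.
  by case/porbitP => t ->; rewrite -permM -expgSr mem_porbit.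
have cS : c \in porbit s' j by have := step _ _ _ (porbit_id s' j); rewrite contract_l.
apply/eqP; rewrite eqEsubset subUset sub1set cS /=.
apply/andP; split; apply: stable; rewrite ?porbit_id ?inE ?porbit_id ?orbT //.
  move=> y; rewrite !inE.
  have [-> _|yc /=] := eqVneq y c; first by rewrite contract_r step ?porbit_id ?orbT.
  have [-> _|yj] := eqVneq y j; first by rewrite contract_l eqxx.
  by move=> yo; rewrite contractE // step ?orbT.
move=> y; have [-> //|yc] := eqVneq y c; first by rewrite sc.
have [-> _|yj] := eqVneq y j.
  by rewrite -contract_r step.
by move=> yo; rewrite -contractE // step.
Qed.

Lemma card_porbit_contract : #|porbit s' j| = #|porbit s j|.+1.
Proof. by rewrite porbit_contract cardsU1 notin_porbit_fixed // eq_sym. Qed.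

Lemma iter_contract_out x t :
  x \notin porbit s' j -> (s' ^+ t)%g x = (s ^+ t)%g x.
Proof.
move=> xo; elim: t => [|t IHt]; first by rewrite !perm1.
rewrite !expgSr permM [in RHS]permM -IHt.
have : (s' ^+ t)%g x \notin porbit s' j.
  by apply: contra xo; rewrite -!eq_porbit_mem porbit_perm.
rewrite porbit_contract !inE negb_or => /andP[zc zo].
by rewrite contractE //; apply: contraNneq zo => ->; rewrite porbit_id.
Qed.

Lemma porbit_contract_out x : x \notin porbit s' j -> porbit s' x = porbit s x.
Proof.
move=> xo; apply/setP => y.
by apply/porbitP/porbitP => -[t ->]; exists t; rewrite iter_contract_out.
Qed.

(** After visiting [c], the walk under [s'] follows the one under [s] a step late, until it returns
    to [j]. *)
Lemma iter_contract_in t :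
  (0 < t <= #|porbit s j|)%N -> (s' ^+ t.+1)%g j = (s ^+ t)%g j.
Proof.
elim: t => // -[_ _|t IHt /andP[_ tlt]].
  by rewrite expgS expg1 expg1 permM contract_l contract_r.
have tlt' : (0 < t.+1 < #|porbit s j|)%N by [].
rewrite [LHS](_ : _ = s' ((s ^+ t.+1)%g j)); last first.
  by rewrite -(IHt (ltnW tlt)) -permM -expgSr.
rewrite contractE; first by rewrite -permM -expgSr.
  exact: porbit_iter_neq.
apply: contra (notin_porbit_fixed (x := j) _) => [/eqP<-|].
  exact: mem_porbit.
by rewrite eq_sym.
Qed.

End Contraction.

(** * Expansion of a row determinant along its distinguished row *)

Section RowDeterminant.
Variables (R : realType) (n : nat).
Local Notation H := (quat R).
Implicit Types (M N : 'M[H]_n) (a : {set 'I_n}) (i j c x : 'I_n).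
Implicit Types (s t : {perm 'I_n}).

(** Splitting off [M j c] leaves a walk from [c] back to [j]. It reads as the cycle of [s] at [j]
    once row [j] holds row [c], since only the first factor of that cycle uses row [j]. *)
Lemma cycle_prod_contract M j c s : c != j -> s c = c ->
  cycle_prod M (tperm j c * s)%g j =
  M j c * cycle_prod (row_repl M j (row c M)) s j.
Proof.
move=> cj sc; rewrite /cycle_prod card_porbit_contract // big_ord_recl.
rewrite expg0 perm1 expg1 contract_l //; congr (_ * _).
apply: eq_bigr => t _; rewrite /= /bump !mxE add1n.
rewrite (iter_contract_in cj sc (t := t.+1)) ?ltn_ord //.
case: (val t) (ltn_ord t) => [|u] ult; first by rewrite expg0 perm1 eqxx expg1 contract_l.
rewrite (iter_contract_in cj sc (t := u.+1)) ?(ltnW ult) //.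
by rewrite (negPf (porbit_iter_neq _)).
Qed.

Lemma eq_cycle_prod M N s x : (forall y z, y \in porbit s x -> M y z = N y z) ->
  cycle_prod M s x = cycle_prod N s x.
Proof. by move=> MN; apply: eq_bigr => t _; rewrite MN // mem_porbit. Qed.

Lemma cycle_prod_contract_out M j c s x : c != j -> s c = c ->
  x \notin porbit (tperm j c * s)%g j ->
  cycle_prod M (tperm j c * s)%g x = cycle_prod (row_repl M j (row c M)) s x.
Proof.
move=> cj sc xo; rewrite /cycle_prod (porbit_contract_out sc xo).
apply: eq_bigr => t _; rewrite !(iter_contract_out sc) // !mxE.
case: eqP => // tj; case/negP: xo; rewrite porbit_contract // !inE.
by rewrite porbit_sym -[X in X \in _]tj mem_porbit orbT.
Qed.

(* Unlike in [cycle_heads] no cycle is singled out: all start with their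
   smallest element, which makes sense for the empty set too. *)
Definition tail_heads a s : seq 'I_n :=
  [seq c <- enum 'I_n | (c \in a) && [forall d in porbit s c, (c <= d)%N]].

Definition mindet M a : H :=
  \sum_(s : {perm 'I_n} | perm_on a s)
    (-1) ^+ (#|a| - size (tail_heads a s)) *
    \prod_(c <- tail_heads a s) cycle_prod M s c.

Lemma porbit_fixed s j : s j = j -> porbit s j = [set j].
Proof.
move=> sj; apply/setP => x; rewrite inE; apply/porbitP/eqP => [[t ->]|->].
  by rewrite permX iter_fix.
by exists 0%N; rewrite perm1.
Qed.

Lemma perm_on_fix a j s : j \notin a ->
  perm_on (j |: a) s && (s j == j) = perm_on a s.
Proof.
move=> ja; apply/andP/idP => [[son /eqP sj]|son].
  apply/subsetP => x; rewrite inE => sx.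
  have := subsetP son x; rewrite !inE => /(_ sx); case: eqP => // xj.
  by rewrite xj sj eqxx in sx.
split; last by rewrite (out_perm son ja).
exact: subset_trans son (subsetUr _ _).
Qed.

Lemma cycle_heads_fixed a j s : j \notin a -> s j = j ->
  cycle_heads (j |: a) s j = j :: tail_heads a s.
Proof.
move=> ja sj; congr cons; apply: eq_filter => x.
rewrite porbit_fixed // !inE; have [->|//] := eqVneq x j.
by rewrite (negPf ja) andbF.
Qed.

Lemma cycle_heads_contract a j c s : j \notin a -> c != j -> s c = c ->
  cycle_heads (j |: a) (tperm j c * s)%g j = cycle_heads (j |: (a :\ c)) s j.
Proof.
move=> ja cj sc; congr cons; apply: eq_filter => x.
have [xo|xo] := boolP (x \in porbit (tperm j c * s)%g j).
  rewrite /= andbF; symmetry; move: xo; rewrite porbit_contract // !inE.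
  by case/orP => [/eqP->|->]; rewrite ?andbF // eqxx (negPf cj).
rewrite (porbit_contract_out sc xo); move: xo; rewrite porbit_contract // !inE.
by rewrite negb_or => /andP[-> ->].
Qed.

(** The bijection behind the expansion: deleting [c] after [j] matches the permutations sending [j]
    to [c] with all those of the smaller set. *)
Lemma perm_on_contract a j c s : j \notin a -> c \in a ->
  perm_on (j |: a) (tperm j c * s)%g && ((tperm j c * s)%g j == c) =
  perm_on (j |: (a :\ c)) s.
Proof.
move=> ja ca; have cj : c != j by apply: contraNneq ja => <-.
have tj : perm_on (j |: a) (tperm j c).
  apply: subset_trans (tperm_on j c) _; apply/subsetP => x.
  by rewrite !inE => /orP[->//|/eqP->]; rewrite ca orbT.
have -> : j |: (a :\ c) = (j |: a) :\ c.
  by apply/setP => x; rewrite !inE; case: (x =P j) => //= ->; rewrite eq_sym cj.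
have sonE : perm_on (j |: a) (tperm j c * s)%g = perm_on (j |: a) s.
  apply/idP/idP => [son|]; last exact: perm_onM.
  by rewrite -[s](mulKg (tperm j c)) tpermV; apply: perm_onM.
rewrite sonE permM tpermL -[RHS](@perm_on_fix _ c) ?inE ?eqxx //.
by rewrite setD1K // !inE ca orbT.
Qed.

(** Makes the truncated subtraction in the sign exponents exact. *)
Lemma size_cycle_heads a i s : i \in a -> (size (cycle_heads a s i) <= #|a|)%N.
Proof.
move=> ia; have u : uniq (cycle_heads a s i).
  by rewrite /= mem_filter porbit_id andbF filter_uniq // enum_uniq.
rewrite -(card_uniqP u); apply/subset_leq_card/subsetP => x.
by rewrite inE => /orP[/eqP->//|]; rewrite mem_filter => /andP[/andP[]].
Qed.

(** Permutations are sorted by the image of [j]. A fixed [j] leaves a minor on [a]; an image [c] is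
    contracted away, which keeps the number of cycles and lowers the size by one, whence the minus
    sign. *)
Lemma rdet_expand M a j : j \notin a ->
  rdet (j |: a) j M = M j j * mindet M a -
    \sum_(c in a) M j c * rdet (j |: (a :\ c)) j (row_repl M j (row c M)).
Proof.
move=> ja; rewrite {1}/rdet.
rewrite (partition_big (fun s : {perm 'I_n} => s j) (mem (j |: a))); last first.
  by move=> s son /=; rewrite (perm_closed _ son) setU11.
rewrite big_setU1 // -sumrN; congr (_ + _).
  rewrite mulr_sumr; under eq_bigl => s do rewrite (perm_on_fix _ ja).
  apply: eq_bigr => s son; have sj := out_perm son ja.
  rewrite cycle_heads_fixed // big_cons cardsU1 ja add1n subSS mulrA.
  rewrite {1}/cycle_prod porbit_fixed // cards1 big_ord1 expg0 expg1 perm1 sj.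
  by rewrite [RHS]mulrA (commr_sign (M j j)).
apply: eq_bigr => c ca; have cj : c != j by apply: contraNneq ja => <-.
rewrite mulr_sumr -sumrN (reindex_inj (mulgI (tperm j c))).
under eq_bigl => s do rewrite (perm_on_contract _ ja ca).
apply: eq_bigr => s son; have sc : s c = c.
  by apply: out_perm son _; rewrite !inE eqxx (negPf cj).
have jU : j \in j |: (a :\ c) by rewrite setU11.
have := size_cycle_heads s jU.
rewrite (cycle_heads_contract ja cj sc) !big_cons.
rewrite !cardsU1 !inE (negPf ja) andbF /= !add1n (cardsD1 c a) ca add1n => szle.
rewrite subSn // exprS mulN1r !mulNr; congr (- _).
rewrite cycle_prod_contract // [RHS]mulrA (commr_sign (M j c)) -!mulrA.
congr (_ * (_ * (_ * _))).
rewrite big_seq_cond [RHS]big_seq_cond; apply: eq_bigr => x.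
rewrite andbT mem_filter => /andP[/and3P[xa xo _] _].
apply: cycle_prod_contract_out => //; rewrite porbit_contract // in_setU1 negb_or xo andbT.
by apply: contraTneq xa => ->; rewrite !inE eqxx (negPf cj).
Qed.

Lemma eq_mindet M N a : (forall x y, x \in a -> M x y = N x y) ->
  mindet M a = mindet N a.
Proof.
move=> MN; apply: eq_bigr => s son; congr (_ * _).
rewrite big_seq_cond [RHS]big_seq_cond; apply: eq_bigr => x.
rewrite andbT mem_filter => /andP[/andP[xa _] _].
apply: eq_cycle_prod => y z /porbitP[t ->]; apply: MN; elim: t => [|t IHt].
  by rewrite perm1.
by rewrite expgSr permM (perm_closed _ son).
Qed.

(** In this form the expansion iterates: of two replacements of row [j] only the last one counts,
    and the other rows stay those of [M]. *)
Lemma rdet_row_repl_expand M a j b : j \notin a ->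
  rdet (j |: a) j (row_repl M j b) = b 0 j * mindet M a -
    \sum_(c in a) b 0 c * rdet (j |: (a :\ c)) j (row_repl M j (row c M)).
Proof.
move=> ja; rewrite rdet_expand // !mxE eqxx; congr (_ * _ - _).
  by apply: eq_mindet => x y xa; rewrite mxE; case: eqP => // xj; rewrite -xj xa in ja.
apply: eq_bigr => c ca; rewrite mxE eqxx; congr (_ * rdet _ _ _).
apply/matrixP => x y; rewrite !mxE; case: eqP => // _.
by case: eqP => // cj; rewrite -cj ca in ja.
Qed.

Lemma mindet0 M : mindet M set0 = 1.
Proof.
rewrite /mindet (big_pred1 1%g) => [|s]; last first.
  by apply/idP/eqP => [/perm_on_id->//|->]; rewrite ?cards0 ?perm_on1.
rewrite cards0 sub0n mul1r /tail_heads.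
by rewrite (eq_filter (a2 := pred0)) ?filter_pred0 ?big_nil // => x; rewrite !inE.
Qed.

(** The least element [j] of [a] works: both lists of heads are then strictly increasing with the
    same members, hence equal. *)
Lemma mindetE M a : a != set0 ->
  exists2 j, j \in a & mindet M a = rdet a j M.
Proof.
case/set0Pn => j0 j0a; case: (arg_minnP (fun x : 'I_n => val x) j0a) => j j_a jmin.
have {j_a} ja : j \in a := j_a.
exists j => //; apply: eq_bigr => s son.
suff -> : cycle_heads a s j = tail_heads a s by [].
have orb x : x \in porbit s j -> x \in a.
  case/porbitP => t ->; elim: t => [|t IHt]; first by rewrite perm1.
  by rewrite expgSr permM (perm_closed _ son).
have ltnI_trans : transitive (relpre (@nat_of_ord n) ltn).
  by move=> x y z; apply: ltn_trans.
have sorted_enumI : sorted (relpre (@nat_of_ord n) ltn) (enum 'I_n).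
  by rewrite -sorted_map val_enum_ord iota_ltn_sorted.
have notinj x : x \in a -> x \notin porbit s j -> (j < x)%N.
  move=> xa xj; rewrite ltn_neqAle jmin // andbT.
  by apply: contraNneq xj => /val_inj<-; rewrite porbit_id.
apply: (irr_sorted_eq ltnI_trans) => [x|||x]; rewrite ?/= ?ltnn //.
- rewrite path_min_sorted; first exact: sorted_filter.
  by apply/allP => x; rewrite mem_filter => /andP[/and3P[xa xj _] _]; apply: notinj.
- exact: sorted_filter.
rewrite inE mem_filter [in RHS]mem_filter mem_enum !andbT.
have [->|xj] := eqVneq x j.
  by rewrite ja; symmetry; apply/forall_inP => d dj; apply/jmin/orb.
have [xo|//] := boolP (x \in porbit s j); rewrite /= andbF.
symmetry; apply/negbTE; rewrite negb_and; apply/orP; right.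
apply/forall_inPn; exists j; first by rewrite porbit_sym.
by rewrite -ltnNge ltn_neqAle (jmin _ (orb _ xo)) andbT eq_sym.
Qed.

End RowDeterminant.
(** * Quaternions and sums over subsets *)

Section QuaternionFacts.
Variable R : realType.
Local Notation H := (quat R).
Implicit Types (x y : H) (a b : R).

Lemma conjq_is_zmod_morphism : zmod_morphism (@conjq R).
Proof. by move=> [????] [????]; congr Quat => /=; ring. Qed.
HB.instance Definition _ :=
  GRing.isZmodMorphism.Build H H (@conjq R) conjq_is_zmod_morphism.

Lemma qr_is_zmod_morphism : zmod_morphism (@qr R).
Proof. by []. Qed.
HB.instance Definition _ :=
  GRing.isZmodMorphism.Build H R (@qr R) qr_is_zmod_morphism.

Lemma quat_of_real_is_zmod_morphism : zmod_morphism (@quat_of_real R).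
Proof. by move=> a b; congr Quat => /=; ring. Qed.
HB.instance Definition _ := GRing.isZmodMorphism.Build R H (@quat_of_real R)
  quat_of_real_is_zmod_morphism.

Lemma quat_of_real_is_monoid_morphism : monoid_morphism (@quat_of_real R).
Proof. by split=> // a b; congr Quat => /=; ring. Qed.
HB.instance Definition _ := GRing.isMonoidMorphism.Build R H (@quat_of_real R)
  quat_of_real_is_monoid_morphism.

Lemma conjqM x y : conjq (x * y) = conjq y * conjq x.
Proof. by case: x y => [????] [????]; congr Quat => /=; ring. Qed.

Lemma conjqK : involutive (@conjq R).
Proof. by case=> ????; rewrite /conjq /= !opprK. Qed.

(** The trace property: under the real part, closed paths can be rotated. *)
Lemma qrM_sym x y : qr (x * y) = qr (y * x).
Proof. by case: x y => [????] [????] /=; ring. Qed.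

Lemma quat_of_realC a x : quat_of_real a * x = x * quat_of_real a.
Proof. by case: x => ????; congr Quat => /=; ring. Qed.

Lemma conj_quat_of_real a : conjq (quat_of_real a) = quat_of_real a.
Proof. by rewrite /conjq /quat_of_real /= oppr0. Qed.

Lemma conjq_realE x : conjq x = x -> quat_of_real (qr x) = x.
Proof.
have opp_eq b : - b = b -> b = 0.
  by move/eqP; rewrite eq_sym -subr_eq0 opprK -mulr2n mulrn_eq0 => /eqP.
by case: x => a b c d /= [] /opp_eq-> /opp_eq-> /opp_eq->.
Qed.

Lemma conjq_realC x y : conjq x = x -> x * y = y * x.
Proof. by move/conjq_realE <-; rewrite quat_of_realC. Qed.

Lemma mulq_conj x : conjq x * x = quat_of_real (normsqq x).
Proof. by case: x => ????; congr Quat; rewrite /normsqq /=; ring. Qed.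

Lemma mulq_eq0 x y : (x * y == 0) = (x == 0) || (y == 0).
Proof.
have [->|x0] := eqVneq x 0; first by rewrite mul0r eqxx.
apply/eqP/eqP => [xy0|->]; last by rewrite mulr0.
by rewrite -[y]mul1r -(Defs.mulVq x0) -mulrA xy0 mulr0.
Qed.

End QuaternionFacts.

Section SubsetSums.
Variables (T : finType) (V : nmodType).
Implicit Types (a s t u v : {set T}) (i c : T).

Lemma sum_subsetU1 a i (f : {set T} -> V) : i \notin a ->
  \sum_(s : {set T} | s \subset i |: a) f s =
  \sum_(s : {set T} | s \subset a) f s + \sum_(s : {set T} | s \subset a) f (i |: s).
Proof.
move=> ia; rewrite (bigID (fun s => i \in s)) [LHS]addrC /=; congr (_ + _).
  apply: eq_bigl => s; apply/andP/idP => [[sa si]|sa].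
    apply/subsetP => x xs; have := subsetP sa x xs; rewrite in_setU1.
    by case/predU1P => // xi; rewrite -xi xs in si.
  by rewrite (subset_trans sa (subsetUr _ _)) (contra (subsetP sa i)).
rewrite (reindex_onto (fun s => i |: s) (fun s => s :\ i)) /=; last first.
  by move=> s /andP[_ si]; rewrite setD1K.
apply: eq_bigl => s; rewrite setU11 andbT.
apply/andP/idP => [[sa /eqP <-]|sa]; first by rewrite subDset.
by rewrite setUS // setU1K // (contra (subsetP sa i)).
Qed.

(** Both sides run over the ordered pairs of disjoint subsets of [a]. *)
Lemma exchange_sum_subsetD a (f : {set T} -> {set T} -> V) :
  \sum_(s : {set T} | s \subset a) \sum_(t : {set T} | t \subset a :\: s) f s t =
  \sum_(t : {set T} | t \subset a) \sum_(s : {set T} | s \subset a :\: t) f s t.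
Proof.
rewrite (exchange_big_dep (fun t => t \subset a)) /= => [|s t _]; last first.
  by rewrite subsetD => /andP[].
apply: eq_bigr => t ta; apply: eq_bigl => s.
by rewrite !subsetD ta /= disjoint_sym.
Qed.

(** Substitute [v = s :\: u]: nested pairs become disjoint pairs. *)
Lemma sum_subset_split a (f : {set T} -> {set T} -> V) :
  \sum_(s : {set T} | s \subset a) \sum_(u : {set T} | u \subset s) f u (s :\: u) =
  \sum_(u : {set T} | u \subset a) \sum_(v : {set T} | v \subset a :\: u) f u v.
Proof.
rewrite (exchange_big_dep (fun u => u \subset a)) /= => [|s u sa us]; last first.
  exact: subset_trans us sa.
apply: eq_bigr => u ua.
rewrite (reindex_onto (fun v => u :|: v) (fun s => s :\: u)) /=; last first.
  by move=> s /andP[_ us]; rewrite setDE setUIr setUCr setIT; apply/setUidPr.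
apply: eq_big => [v|v /andP[_ /eqP->]//].
rewrite subUset ua subsetUl !andbT /= subsetD; congr (_ && _).
by rewrite setDUl setDv set0U; apply/eqP/setDidPl.
Qed.

Lemma sum_subset_elem a (f : T -> {set T} -> V) :
  \sum_(s : {set T} | s \subset a) \sum_(c in s) f c (s :\ c) =
  \sum_(c in a) \sum_(s : {set T} | s \subset a :\ c) f c s.
Proof.
rewrite (exchange_big_dep (mem a)) /= => [|s c sa cs]; last exact: (subsetP sa).
apply: eq_bigr => c ca.
rewrite (reindex_onto (fun s => c |: s) (fun s => s :\ c)) /=; last first.
  by move=> s /andP[_ cs]; rewrite setD1K.
apply: eq_big => [s|s /andP[_ /eqP->]//].
rewrite subUset sub1set ca setU11 subsetD1 /= andbT; congr (_ && _).
by apply/eqP/idP => [<-|/setU1K//]; rewrite !inE eqxx.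
Qed.

End SubsetSums.
(** * Signed path weights and Hermitian minors *)

Lemma setDAC (T : finType) (a b c : {set T}) : a :\: b :\: c = a :\: c :\: b.
Proof. by rewrite !setDDl setUC. Qed.

Section PathWeights.
Variables (R : realType) (n : nat) (M : 'M[quat R]_n).
Local Notation H := (quat R).
Implicit Types (a b s u : {set 'I_n}) (c d i j x : 'I_n).

(** The fuel [k] is meant to be the size of [s], so that [s] is empty when it runs out. *)
Fixpoint path_weight_rec k x j s : H :=
  if k is k'.+1 then - \sum_(c in s) M x c * path_weight_rec k' c j (s :\ c)
  else M x j.

(* [path_weight x j s] is the sum of [(-1) ^+ #|s| * m_{x c1} ... m_{cl j}]
   over the orderings [c1, ..., cl] of [s]. *)
Definition path_weight x j s := path_weight_rec #|s| x j s.
Local Notation W := path_weight.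

Lemma path_weight0 x j : W x j set0 = M x j.
Proof. by rewrite /path_weight cards0. Qed.

Lemma path_weightE x j s : s != set0 ->
  W x j s = - \sum_(c in s) M x c * W c j (s :\ c).
Proof.
rewrite -cards_eq0 /path_weight; case k: #|s| => [//|l] _ /=; congr (- _).
by apply: eq_bigr => c cs; rewrite (cardsD1 c) cs add1n in k; case: k => ->.
Qed.

Lemma sum_path_weight a x j (f : {set 'I_n} -> H) :
  \sum_(s : {set 'I_n} | s \subset a) W x j s * f s =
  M x j * f set0 - \sum_(c in a) M x c *
    \sum_(s : {set 'I_n} | s \subset a :\ c) W c j s * f (c |: s).
Proof.
pose g c s := M x c * (W c j s * f (c |: s)).
transitivity (M x j * f set0 -
    \sum_(s : {set 'I_n} | s \subset a) \sum_(c in s) g c (s :\ c)).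
  rewrite -sumrN (bigD1 set0) ?sub0set // [in RHS](bigD1 set0) ?sub0set //=.
  rewrite big_set0 oppr0 add0r path_weight0; congr (_ + _).
  apply: eq_bigr => s /andP[_ s0]; rewrite path_weightE // mulNr mulr_suml.
  by congr (- _); apply: eq_bigr => c cs; rewrite /g setD1K // mulrA.
rewrite sum_subset_elem; congr (_ - _).
by apply: eq_bigr => c _; rewrite mulr_sumr.
Qed.

(** Each path through [i] is cut there into a path from [x] to [i] and one from [i] to [j]; the
    inner vertex [i] itself accounts for the sign. *)
Lemma path_weight_cut x i j s : i \notin s ->
  W x j (i |: s) =
  - \sum_(u : {set 'I_n} | u \subset s) W x i u * W i j (s :\: u).
Proof.
move: {2}#|s| (leqnn #|s|) => k; elim: k s x => [|k IHk] s x cs si.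
all: rewrite path_weightE; last by apply/set0Pn; exists i; rewrite setU11.
all: rewrite big_setU1 //= setU1K // sum_path_weight setD0; congr (- (_ + _)).
  by move: cs; rewrite leqn0 cards_eq0 => /eqP->; rewrite !big_set0 oppr0.
rewrite -sumrN; apply: eq_bigr => c cs'; rewrite -mulrN; congr (_ * _).
have -> : (i |: s) :\ c = i |: (s :\ c).
  apply/setP => y; rewrite !inE; case: (y =P i) => //= ->.
  by rewrite andbT; apply: contraNneq si => ->.
rewrite IHk; first by congr (- _); apply: eq_bigr => u _; rewrite setDDl.
  by move: cs; rewrite (cardsD1 c) cs'.
by rewrite !inE (negPf si) andbF.
Qed.

(** The last step is split off instead of the first. The induction takes off one step at each end,
    which requires two inner vertices, so singletons are treated apart. *)
Lemma path_weightEr x j s : s != set0 ->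
  W x j s = - \sum_(c in s) W x c (s :\ c) * M c j.
Proof.
move: {2}#|s| (leqnn #|s|) => k; elim: k s x => [|k IHk] s x cs s0.
  by rewrite leqn0 cards_eq0 (negPf s0) in cs.
rewrite path_weightE //; congr (- _).
have [[e sE]|] := pselect (exists e, s = [set e]).
  by rewrite sE !big_set1 setDv !path_weight0.
move=> ns1; have sD0 c : c \in s -> s :\ c != set0.
  move=> cs'; apply/eqP => sc; apply: ns1; exists c.
  by rewrite -(setD1K cs') sc setU0.
transitivity (\sum_(c in s) \sum_(d in s :\ c)
   - (M x c * W c d (s :\ c :\ d) * M d j)).
  apply: eq_bigr => c cs'; rewrite IHk ?sD0 //; last first.
    by move: cs; rewrite (cardsD1 c) cs'.
  rewrite mulrN mulr_sumr -sumrN.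
  by apply: eq_bigr => d _; rewrite mulrA.
rewrite (exchange_big_dep (mem s)) /= => [|c d _]; last by rewrite !inE => /andP[].
apply: eq_bigr => d ds; rewrite path_weightE ?sD0 // mulNr mulr_suml sumrN.
congr (- _); apply: eq_big => [c|c _]; last by rewrite setDAC.
by rewrite !inE ds andbT eq_sym andbC.
Qed.

(** Conjugation reverses products, so the expansion by the first step turns into the one by the last
    step. *)
Lemma conj_path_weight x j s : qhermitian M -> conjq (W x j s) = W j x s.
Proof.
move=> hM; have conjM y z : conjq (M y z) = M z y.
  by rewrite -[in RHS]hM !mxE.
move: {2}#|s| (erefl #|s|) => k; elim: k s x => [|k IHk] s x cs.
  by move/eqP: cs; rewrite cards_eq0 => /eqP->; rewrite !path_weight0.
have s0 : s != set0 by rewrite -cards_eq0 cs.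
rewrite path_weightE // path_weightEr // raddfN raddf_sum; congr (- _).
apply: eq_bigr => c cs' /=; rewrite conjqM conjM IHk //.
by rewrite (cardsD1 c) cs' add1n in cs; case: cs.
Qed.

(* The bordered minor: for j outside a, the row determinant at j of the
   submatrix on j |: a after row j has been replaced by row x. *)
Definition minorF a x j : H :=
  \sum_(s : {set 'I_n} | s \subset a) W x j s * mindet M (a :\: s).
Local Notation F := minorF.
Local Notation D := (mindet M).

Lemma minorF_expand a x j :
  F a x j = M x j * D a - \sum_(c in a) M x c * F (a :\ c) c j.
Proof.
rewrite /minorF sum_path_weight setD0; congr (_ - _).
apply: eq_bigr => c _; congr (_ * _); apply: eq_bigr => s _.
by rewrite setDDl.
Qed.

(** Both sides satisfy the same recursion on [a]; [x] stays general because each step changes the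
    row put in place of row [j]. *)
Lemma rdet_row_repl_row a x j : j \notin a ->
  rdet (j |: a) j (row_repl M j (row x M)) = F a x j.
Proof.
move: {2}#|a| (leqnn #|a|) => k; elim: k a x => [|k IHk] a x ca ja.
all: rewrite rdet_row_repl_expand // minorF_expand mxE; congr (_ - _).
  by move: ca; rewrite leqn0 cards_eq0 => /eqP->; rewrite !big_set0.
apply: eq_bigr => c cs; rewrite mxE IHk //; first by move: ca; rewrite (cardsD1 c) cs.
by rewrite !inE (negPf ja) andbF.
Qed.

Lemma rdet_minorF a j : j \in a -> rdet a j M = F (a :\ j) j j.
Proof.
move=> ja; rewrite -rdet_row_repl_row ?setD11 // setD1K //; congr rdet.
by apply/matrixP => x y; rewrite !mxE; case: eqP => // ->.
Qed.

(** The paths avoiding [i] give the first sum; those through [i] are cut at [i] and give the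
    second. *)
Lemma minorF_setU1 b i x j : i \notin b ->
  F (i |: b) x j =
  \sum_(s : {set 'I_n} | s \subset b) W x j s * D (i |: (b :\: s)) -
  \sum_(u : {set 'I_n} | u \subset b) W x i u * F (b :\: u) i j.
Proof.
move=> ib; rewrite /minorF (sum_subsetU1 _ ib); congr (_ + _).
  apply: eq_bigr => s sb; congr (_ * D _); apply/setP => y; rewrite !inE.
  by have [->|] := eqVneq y i; rewrite ?andbF //= (contra (subsetP sb i) ib).
transitivity (- \sum_(s : {set 'I_n} | s \subset b)
  \sum_(u : {set 'I_n} | u \subset s) W x i u * W i j (s :\: u) * D (b :\: u :\: (s :\: u))).
  rewrite -sumrN; apply: eq_bigr => s sb.
  rewrite path_weight_cut ?(contra (subsetP sb i)) // mulNr mulr_suml; congr (- _).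
  apply: eq_bigr => u us; congr (_ * D _); apply/setP => y; rewrite !inE.
  have [->|yi] := eqVneq y i; first by rewrite (negPf ib) !andbF.
  by move: (subsetP us y); case: (y \in u) => [->//|_]; case: (y \in s).
rewrite (sum_subset_split b (fun u v => W x i u * W i j v * D (b :\: u :\: v))).
congr (- _); apply: eq_bigr => u _; rewrite mulr_sumr.
by apply: eq_bigr => v _; rewrite mulrA.
Qed.

Hypothesis hM : qhermitian M.

Lemma conj_minorF b x j :
  (forall a, a \subset b -> conjq (D a) = D a) -> conjq (F b x j) = F b j x.
Proof.
move=> Dr; rewrite raddf_sum; apply: eq_bigr => s sb /=.
by rewrite conjqM conj_path_weight // Dr ?subsetDl // conjq_realC ?Dr ?subsetDl.
Qed.

(* The two sums cancel for x = i, and are symmetric in i and j up to cyclic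
   permutations under the real part for x = j. *)
Lemma minorF_setU1_real b i x j : i \notin b ->
    (forall a, a \subset b -> conjq (D a) = D a) ->
    (forall a, a \subset b -> F a i i = D (i |: a)) ->
  F (i |: b) x j =
  \sum_(t : {set 'I_n} | t \subset b) W i i t * F (b :\: t) x j -
  \sum_(u : {set 'I_n} | u \subset b) W x i u * F (b :\: u) i j.
Proof.
move=> ib Dr FD; rewrite minorF_setU1 //; congr (_ - _).
have := exchange_sum_subsetD b (fun s t => W i i t * W x j s * D (b :\: s :\: t)).
under [in X in _ = X -> _]eq_bigr => t tb.
  under eq_bigr => s sb do rewrite setDDl setUC -setDDl -mulrA.
  rewrite -mulr_sumr; over.
move=> <-; apply: eq_bigr => s sb.
have Db : conjq (D (i |: b :\: s)) = D (i |: b :\: s).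
  rewrite -FD ?subsetDl // conj_minorF // => a ab.
  by apply/Dr/(subset_trans ab); exact: subsetDl.
rewrite -(conjq_realC _ Db) -FD ?subsetDl // mulr_suml; apply: eq_bigr => t tb.
by rewrite -!mulrA (conjq_realC (W x j s)) // Dr // !subDset setUA subsetUr.
Qed.

(** Both claims go through one induction on the size of [a]. Real smaller minors make every
    [F (a :\ i) i i] real, so that independence of [i] need only be checked on real parts; [mindetE]
    then ties the common value to [D a]. *)
Lemma minorF_hermitian a :
  conjq (D a) = D a /\ forall j, j \in a -> F (a :\ j) j j = D a.
Proof.
move: {2}#|a| (leqnn #|a|) => k; elim: k a => [|k IHk] a.
  rewrite leqn0 cards_eq0 => /eqP->; rewrite mindet0; split=> [|j]; last by rewrite inE.
  by rewrite /conjq /= oppr0.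
move=> ca; have [->|a0] := eqVneq a set0; first by apply: IHk; rewrite cards0.
have Dr b i : i \in a -> b \subset a :\ i -> conjq (D b) = D b.
  move=> ia bai; have [] // := IHk b _.
  rewrite (leq_trans (subset_leq_card bai)) // -ltnS (leq_trans _ ca) //.
  by rewrite [X in (_ < X)%N](cardsD1 i) ia.
have Fr i : i \in a -> conjq (F (a :\ i) i i) = F (a :\ i) i i.
  by move=> ia; rewrite conj_minorF // => b ba; apply: Dr ba.
have FF i j : i \in a -> j \in a -> i != j -> F (a :\ j) j j = F (a :\ i) i i.
  move=> ia ja ij; rewrite -(conjq_realE (Fr _ ia)) -(conjq_realE (Fr _ ja)).
  congr quat_of_real; set b := a :\ i :\ j.
  have [bi bj] : i \notin b /\ j \notin b by rewrite !inE !eqxx !andbF.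
  have aiE : a :\ i = j |: b by rewrite /b setD1K // !inE eq_sym ij.
  have ajE : a :\ j = i |: b by rewrite /b setDAC setD1K // !inE ij.
  have FD c d : c \in a -> d \in a -> c != d ->
      forall e : {set 'I_n}, e \subset a :\ c :\ d -> F e c c = D (c |: e).
    move=> ca' da cd e ee; have ce : c \notin e.
      by apply/negP => /(subsetP ee); rewrite !inE eqxx andbF.
    have [] := IHk (c |: e); last first.
      by move=> _ /(_ c); rewrite setU11 setU1K // => ->.
    rewrite -ltnS (leq_trans _ ca) // (cardsD1 d a) da ltnS.
    apply: subset_leq_card; rewrite subUset sub1set !inE cd ca'.
    by apply: (subset_trans ee); rewrite setDAC; exact: subsetDl.
  have Drb (e : {set 'I_n}) : e \subset b -> conjq (D e) = D e.
    by move=> eb; apply: (Dr e i ia); apply: (subset_trans eb); exact: subsetDl.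
  (* The left side is expanded in the reordered form and the right side directly, so that the first
     sums agree term by term by induction. *)
  rewrite ajE minorF_setU1_real // ?aiE ?minorF_setU1 //; last exact: FD.
  rewrite [LHS]raddfB [RHS]raddfB; congr (_ - _).
    congr qr; apply: eq_bigr => t tb; congr (_ * _); apply: (FD j i) => //.
      by rewrite eq_sym.
    by rewrite setDAC; exact: subsetDl.
  rewrite !raddf_sum.
  under eq_bigr => u _ do rewrite mulr_sumr raddf_sum.
  under [RHS]eq_bigr => u _ do rewrite mulr_sumr raddf_sum.
  (* A path from [i] to [j] and one back form a closed path; once the sums are exchanged, rotating
     it matches the terms. *)
  rewrite [RHS](exchange_sum_subsetD b (fun u v => qr (W i j u * (W j i v * D (b :\: u :\: v))))).
  apply: eq_bigr => u ub; apply: eq_bigr => v vb.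
  have De : conjq (D (b :\: u :\: v)) = D (b :\: u :\: v).
    by apply/Drb/(subset_trans (subsetDl _ _))/subsetDl.
  by rewrite [RHS]qrM_sym setDAC -mulrA (conjq_realC _ De).
have [j ja DE] := mindetE M a0; rewrite rdet_minorF // in DE.
split=> [|i ia]; rewrite DE ?Fr //.
by have [->//|ij] := eqVneq i j; apply: FF; rewrite // eq_sym.
Qed.

End PathWeights.
(** * The adjugate and its coefficients *)

Lemma sum_setU1_notin (T : finType) (V : nmodType) j (P : pred {set T})
    (f : {set T} -> V) :
  \sum_(a : {set T} | P a && (j \in a)) f a =
  \sum_(a : {set T} | P (j |: a) && (j \notin a)) f (j |: a).
Proof.
rewrite (reindex_onto (fun a => j |: a) (fun a => a :\ j)) /=; last first.
  by move=> a /andP[_ ja]; rewrite setD1K.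
apply: eq_bigl => a; rewrite setU11 andbT; congr (_ && _).
by apply/eqP/idP => [<-|/setU1K//]; rewrite !inE eqxx.
Qed.

Section Adjugate.
Variables (R : realType) (n : nat) (M : 'M[quat R]_n).
Local Notation H := (quat R).
Local Notation F := (minorF M).
Local Notation D := (mindet M).
Implicit Types (a b : {set 'I_n}) (c d i j x : 'I_n) (s : nat).

(* The coefficients of t^(n-s) in det(tI + M), and of t^(n-1-s) in the adjugate
   of tI + M. *)
Definition char_coef s : H := \sum_(a : {set 'I_n} | #|a| == s) D a.
Definition adj_coef s : 'M[H]_n := \matrix_(c, j)
  if c == j then \sum_(a : {set 'I_n} | (#|a| == s) && (j \notin a)) D a
  else - \sum_(a : {set 'I_n} | (#|a|.+1 == s) && (j \notin a) && (c \notin a)) F a c j.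

(** Turns the numerator of the formula into an entry of a matrix product: the expansion is linear in
    [b] with coefficients on the right, and its terms are collected by the index [c] of [b]. *)
Lemma sum_rdet_row_repl s j (b : 'rV[H]_n) :
  \sum_(a : {set 'I_n} | (#|a| == s.+1) && (j \in a)) rdet a j (row_repl M j b) =
  (b *m adj_coef s) 0 j.
Proof.
rewrite (sum_setU1_notin j (fun a => #|a| == s.+1)) /=.
under eq_bigl => a do rewrite cardsU1.
transitivity (\sum_(a : {set 'I_n} | (#|a| == s) && (j \notin a))
   (b 0 j * D a - \sum_(c in a) b 0 c * F (a :\ c) c j)).
  apply: eq_big => [a|a /andP[_ ja]]; first by case: (j \in a); rewrite ?andbF.
  rewrite rdet_row_repl_expand //; congr (_ - _).
  by apply: eq_bigr => c ca; rewrite rdet_row_repl_row // !inE (negPf ja) andbF.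
rewrite sumrB mxE (bigD1 j) //= mxE eqxx mulr_sumr; congr (_ + _).
rewrite (exchange_big_dep (fun c => c != j)) /= => [|a c /andP[_ ja] ca]; last first.
  by apply: contraNneq ja => <-.
rewrite -sumrN; apply: eq_bigr => c cj; rewrite mxE (negPf cj) mulrN; congr (- _).
rewrite mulr_sumr (sum_setU1_notin c (fun a => (#|a| == s) && (j \notin a))) /=.
apply: eq_big => [a|a /andP[_ ca]]; last by rewrite setU1K.
by rewrite !inE negb_or (eq_sym j c) cj cardsU1 /=; case: (c \in a); rewrite ?andbF.
Qed.

Lemma adj_coef0 : adj_coef 0 = 1%:M.
Proof.
apply/matrixP => c j; rewrite !mxE; case: eqP => _; last first.
  by rewrite big_pred0 ?oppr0.
rewrite (big_pred1 set0) ?mindet0 // => a; rewrite cards_eq0.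
by apply/andP/eqP => [[/eqP]|->]; rewrite ?inE.
Qed.

Lemma adj_coef_out s : (n <= s)%N -> adj_coef s = 0.
Proof.
move=> ns; have card_lt a j : j \notin a -> (#|a| < n)%N.
  move=> ja; rewrite -[n in (_ < n)%N]card_ord -cardsT; apply: proper_card.
  by rewrite properE subsetT; apply/subsetPn; exists j; rewrite ?inE.
apply/matrixP => c j; rewrite !mxE; case: eqP => cj.
  by rewrite big_pred0 // => a; apply/negP => /andP[/eqP as_ /card_lt]; rewrite as_ ltnNge ns.
rewrite big_pred0 ?oppr0 // => a; apply/negP => /andP[/andP[/eqP as_ ja] ca].
have := card_lt (c |: a) j; rewrite !inE negb_or ja eq_sym.
by move/eqP: cj => -> /(_ isT); rewrite cardsU1 ca add1n as_ ltnNge ns.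
Qed.

Lemma char_coef0 : char_coef 0 = 1.
Proof.
by rewrite /char_coef (big_pred1 set0) ?mindet0 // => a; rewrite cards_eq0.
Qed.

(** Each subset of size [s] is counted once for every index outside it. *)
Lemma sum_diag_adj_coef s : \sum_j adj_coef s j j = char_coef s *+ (n - s).
Proof.
under eq_bigr => j _ do rewrite mxE eqxx.
rewrite (exchange_big_dep (fun a => #|a| == s)) /= => [|j a _ /andP[]//].
rewrite /char_coef -sumrMnl; apply: eq_bigr => a /eqP as_.
rewrite (eq_bigl (fun j => j \in ~: a)) => [|j]; last by rewrite in_setC as_ eqxx.
by rewrite sumr_const -as_ cardsCs setCK card_ord.
Qed.

Hypothesis hM : qhermitian M.

Lemma mindet_real a : quat_of_real (qr (D a)) = D a.
Proof. by apply: conjq_realE; case: (minorF_hermitian hM a). Qed.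

Lemma minorF_diag a j : j \notin a -> F a j j = D (j |: a).
Proof.
move=> ja; have [_ /(_ j)] := minorF_hermitian hM (j |: a).
by rewrite setU11 setU1K // => ->.
Qed.

(** Two equal rows: row [i] stands in its own place and in the bordering one, and the two sums of
    [minorF_setU1_real] coincide. *)
Lemma minorF_eq0 a i j : i \in a -> F a i j = 0.
Proof.
move=> ia; rewrite -(setD1K ia) minorF_setU1_real ?setD11 ?subrr // => b bi.
  by case: (minorF_hermitian hM b).
by rewrite minorF_diag //; apply/negP => /(subsetP bi); rewrite setD11.
Qed.

(** All row determinants on [a] equal the real [D a], and an element of [a] forces the value chosen
    in [hdet]. *)
Lemma hdetE a : a != set0 -> quat_of_real (hdet a M) = D a.
Proof.
case/set0Pn => i ia; have rdetE j : j \in a -> rdet a j M = quat_of_real (qr (D a)).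
  by move=> ja; rewrite mindet_real rdet_minorF //; case: (minorF_hermitian hM a) => _ ->.
rewrite -[RHS]mindet_real; congr quat_of_real.
apply: classical_sets.xget_unique => // d /(_ _ ia); rewrite rdetE // => [[]].
by [].
Qed.

(* The Faddeev-LeVerrier recursion. *)
Lemma adj_coef_rec s : M *m adj_coef s + adj_coef s.+1 = (char_coef s.+1)%:M.
Proof.
apply/matrixP => i j; rewrite mxE.
have -> : (M *m adj_coef s) i j =
    \sum_(a : {set 'I_n} | (#|a| == s) && (j \notin a)) F a i j.
  transitivity ((row i M *m adj_coef s) 0 j).
    by rewrite -row_mul [RHS]mxE.
  rewrite -sum_rdet_row_repl (sum_setU1_notin j (fun a => #|a| == s.+1)) /=.
  apply: eq_big => [a|a /andP[_ ja]]; last by rewrite rdet_row_repl_row.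
  by rewrite cardsU1; case: (j \in a); rewrite ?andbF.
(* Off the diagonal, the subsets containing [i] contribute zero and the others cancel. On the
   diagonal, the two sums are the minors with and without [j]. *)
rewrite [adj_coef _ _ _]mxE [RHS]mxE; case: eqVneq => [->|ij]; last first.
  rewrite (bigID (fun a => i \in a)) /= big1 ?add0r ?mulr0n => [|a /andP[_ /minorF_eq0//]].
  by apply/eqP; rewrite subr_eq0.
rewrite mulr1n /char_coef [RHS](bigID (fun a => j \in a)) /=; congr (_ + _).
rewrite (sum_setU1_notin j (fun a => #|a| == s.+1)) /=.
apply: eq_big => [a|a /andP[_ ja]]; last by rewrite minorF_diag.
by rewrite cardsU1; case: (j \in a); rewrite ?andbF.
Qed.

(* The adjugate of the principal submatrix of M on a. *)
Definition adj_entry a c j : H := if c == j then D (a :\ j) else - F (a :\ j :\ c) c j.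

(** The sum is the expansion of [F (a :\ j) i j], which has a repeated row unless [i = j]. *)
Lemma adj_entryE a i j : i \in a -> j \in a ->
  \sum_(c in a) M i c * adj_entry a c j = if i == j then D a else 0.
Proof.
move=> ia ja; transitivity (F (a :\ j) i j); last first.
  have [->|ij] := eqVneq i j; last by rewrite minorF_eq0 // !inE ij.
  by rewrite minorF_diag ?setD11 // setD1K.
rewrite minorF_expand (bigD1 j) //= /adj_entry eqxx -sumrN; congr (_ + _).
apply: eq_big => [c|c /andP[_ /negPf->]]; first by rewrite !inE andbC.
by rewrite mulrN.
Qed.

(** Conjugating a right relation between the columns gives a left relation between the rows of the
    Hermitian [M]. Multiplying it on the right by the adjugate leaves each coefficient times [D a],
    and there are no zero divisors. *)
Lemma mindet_not_rfree a : ~ rfree_cols M a -> D a = 0.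
Proof.
move=> nfree; apply: contrapT => Da; apply: nfree => v va Mv.
apply/colP => l; rewrite mxE; have [la|la] := boolP (l \in a); last exact: va.
have vM x : \sum_(i in a) conjq (v i 0) * M i x = 0.
  have /(congr1 (fun w : 'cV[H]_n => conjq (w x 0))) := Mv.
  rewrite !mxE (raddf0 (@conjq R)) raddf_sum => Mvx.
  rewrite -[RHS]Mvx [RHS](bigID (mem a)) /= [X in _ = _ + X]big1 => [|i ia]; last first.
    by rewrite va // mulr0 raddf0.
  rewrite addr0; apply: eq_bigr => i _; rewrite conjqM; congr (_ * _).
  by rewrite -[in LHS]hM !mxE.
have : conjq (v l 0) * D a = 0.
  transitivity (\sum_(x in a) (\sum_(i in a) conjq (v i 0) * M i x) * adj_entry a x l).
    under eq_bigr => x _ do rewrite mulr_suml.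
    rewrite exchange_big /= (bigD1 l) //= [X in _ = _ + X]big1 ?addr0.
      under eq_bigr => x _ do rewrite -mulrA.
      by rewrite -mulr_sumr adj_entryE // eqxx.
    move=> i /andP[ia /negPf il]; under eq_bigr => x _ do rewrite -mulrA.
    by rewrite -mulr_sumr adj_entryE // il mulr0.
  by apply: big1 => x _; rewrite vM mul0r.
move/eqP; rewrite mulq_eq0 => /orP[/eqP vl|/eqP//].
by rewrite -[LHS]conjqK vl raddf0.
Qed.

End Adjugate.
(** * Rank, index and the Drazin inverse *)

Lemma col_mul (S : pzSemiRingType) m n p (j : 'I_p) (A : 'M[S]_(m, n)) (B : 'M_(n, p)) :
  col j (A *m B) = A *m col j B.
Proof. by apply/colP => i; rewrite !mxE; apply: eq_bigr => l _; rewrite mxE. Qed.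

(** Powers of [a] and of an inverse telescope to [z = a ^+ l * z ^+ l.+1]; with [l = k], both
    inverses then equal [x * a * y]. *)
Lemma drazin_unique (S : pzRingType) (k : nat) (a x y : S) :
  a ^+ k.+1 * x = a ^+ k -> x * a * x = x -> a * x = x * a ->
  a ^+ k.+1 * y = a ^+ k -> y * a * y = y -> a * y = y * a ->
  x = y.
Proof.
have powE z : z * a * z = z -> a * z = z * a ->
    forall l, a ^+ l * z ^+ l.+1 = z /\ z ^+ l.+1 * a ^+ l = z.
  move=> zaz az; have azC l : GRing.comm (a ^+ l) z by apply/commr_sym/commrX/commr_sym.
  elim=> [|l [IHl IHr]]; first by rewrite mul1r mulr1 expr1.
  have zl : z ^+ l.+2 * a ^+ l.+1 = z.
    by rewrite exprS [a ^+ _]exprSr -mulrA [X in z * X]mulrA IHr -az mulrA zaz.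
  by split=> //; rewrite (commrX l.+2 (azC l.+1)).
move=> ax xax xa ay yay ya.
have [_ xE] := powE x xax xa k; have [yE _] := powE y yay ya k.
have xC : a ^+ k.+1 * x = x * a ^+ k.+1 by apply/commr_sym/commrX/commr_sym.
transitivity (x * a * y).
  rewrite -[LHS]xE -ay mulrA; congr (_ * y).
  by rewrite (exprSr a) mulrA xE.
by rewrite -[RHS]yE -ax xC (exprS a) -!mulrA yE.
Qed.

Section HermitianRank.
Variable R : realType.
Local Notation H := (quat R).

Lemma ctransmxM m n p (A : 'M[H]_(m, n)) (B : 'M[H]_(n, p)) :
  ctransmx (A *m B) = ctransmx B *m ctransmx A.
Proof.
apply/matrixP => i j; rewrite !mxE raddf_sum; apply: eq_bigr => l _.
by rewrite !mxE /= conjqM.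
Qed.

Lemma ctransmxK m n (A : 'M[H]_(m, n)) : ctransmx (ctransmx A) = A.
Proof. by apply/matrixP => i j; rewrite !mxE conjqK. Qed.

Lemma qhermitianX n (A : 'M[H]_n) k : qhermitian A -> qhermitian (A ^+ k).
Proof.
move=> hA; elim: k => [|k IHk].
  apply/matrixP => i j; rewrite !mxE eq_sym.
  by case: eqP => _; rewrite ?raddf0 // /conjq /= oppr0.
by rewrite /qhermitian {1}exprS [LHS](ctransmxM A (A ^+ k)) IHk hA exprSr.
Qed.

Lemma gramE n (w : 'cV[H]_n) :
  (ctransmx w *m w) 0 0 = quat_of_real (\sum_p normsqq (w p 0)).
Proof.
by rewrite mxE raddf_sum; apply: eq_bigr => p _; rewrite !mxE mulq_conj.
Qed.

Lemma normsqq_ge0 (x : H) : 0 <= normsqq x.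
Proof. by rewrite /normsqq !addr_ge0 ?sqr_ge0. Qed.

Lemma sum_normsqq_eq0 n (w : 'cV[H]_n) : \sum_p normsqq (w p 0) = 0 -> w = 0.
Proof.
move=> /psumr_eq0P w0; apply/colP => p; rewrite mxE; apply/eqP.
by rewrite -normsqq_eq0 w0 // => q _; apply: normsqq_ge0.
Qed.

(** For each column [v] of [X], the vector [A *m v] has squared norm zero. *)
Lemma gram_ker m n p (A : 'M[H]_(m, n)) (X : 'M[H]_(n, p)) :
  ctransmx A *m A *m X = 0 -> A *m X = 0.
Proof.
move=> AAX; apply/matrixP => i j; rewrite [RHS]mxE.
suff : A *m col j X = 0 by rewrite -col_mul => /colP/(_ i); rewrite !mxE.
apply: sum_normsqq_eq0; have := gramE (A *m col j X).
rewrite ctransmxM -mulmxA (mulmxA _ A) -(col_mul j _ X) AAX col0 mulmx0 mxE.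
by move/(congr1 (@qr R)).
Qed.

Lemma hermitian_ker n p (A : 'M[H]_n) (X : 'M[H]_(n, p)) :
  qhermitian A -> A *m A *m X = 0 -> A *m X = 0.
Proof. by move=> hA AAX; apply: gram_ker; rewrite hA. Qed.

(** Induction on [a]: a suitable [y] gives [y^* M y = D (a :\ j) * D a], and the left side is the
    squared norm of [A *m y], which is positive by freeness. *)
Lemma mindet_gram_gt0 m n (A : 'M[H]_(m, n)) (a : {set 'I_n}) :
  rfree_cols A a -> 0 < qr (mindet (ctransmx A *m A) a).
Proof.
set M := ctransmx A *m A; have hM : qhermitian M by rewrite /qhermitian ctransmxM ctransmxK.
move: {2}#|a| (leqnn #|a|) => k; elim: k a => [|k IHk] a.
  by rewrite leqn0 cards_eq0 => /eqP-> _; rewrite mindet0 ltr01.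
have [->|/set0Pn[j ja] ca freea] := eqVneq a set0; first by rewrite mindet0 ltr01.
have freeaj : rfree_cols A (a :\ j).
  by move=> v vaj; apply: freea => i ia; rewrite vaj // !inE (negPf ia) andbF.
have Daj : 0 < qr (mindet M (a :\ j)).
  by apply: IHk => //; move: ca; rewrite (cardsD1 j) ja.
(* Column [j] of the adjugate on [a], extended by zero: [M *m y] vanishes on [a] except at [j], and
   [y] is nonzero at [j] by induction. *)
pose y : 'cV[H]_n := \col_x if x \in a then adj_entry M a x j else 0.
have yj : y j 0 = mindet M (a :\ j) by rewrite mxE ja /adj_entry eqxx.
have := gramE (A *m y); rewrite ctransmxM -mulmxA (mulmxA _ A) -/M.
have -> : (ctransmx y *m (M *m y)) 0 0 = mindet M (a :\ j) * mindet M a.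
  have My i : i \in a -> (M *m y) i 0 = if i == j then mindet M a else 0.
    move=> ia; rewrite -(adj_entryE hM ia ja) mxE (bigID (mem a)) /=.
    rewrite [X in _ + X]big1 ?addr0 => [|x xa]; last by rewrite [y _ _]mxE (negPf xa) mulr0.
    by apply: eq_bigr => x xa; rewrite [y _ _]mxE xa.
  rewrite mxE (bigD1 j) //= big1 ?addr0 => [|i ij].
    rewrite My // eqxx [ctransmx _ _ _]mxE [map_mx _ _ _ _]mxE.
    by rewrite yj -(mindet_real hM) conj_quat_of_real.
  have [ia|/negPf ia] := boolP (i \in a); first by rewrite My // (negPf ij) mulr0.
  by rewrite [ctransmx _ _ _]mxE [map_mx _ _ _ _]mxE [y _ _]mxE ia raddf0 mul0r.
rewrite -(mindet_real hM (a :\ j)) => /(congr1 (@qr R)) /=.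
rewrite !mul0r !subr0 => /esym DE.
rewrite -(pmulr_rgt0 _ Daj) -DE lt_neqAle sumr_ge0 ?andbT => [|p _]; last exact: normsqq_ge0.
rewrite eq_sym; apply/eqP => /sum_normsqq_eq0 Ay.
have y0 : y = 0 by apply: freea Ay => i /negPf ia; rewrite mxE ia.
by move: Daj; rewrite -yj y0 mxE ltxx.
Qed.

(** * Rank and characteristic coefficients *)

Lemma qrank_free m n (A : 'M[H]_(m, n)) :
  exists2 a : {set 'I_n}, rfree_cols A a & #|a| = qrank A.
Proof.
have free0 : (0 < #|[pred S : {set 'I_n} | `[< rfree_cols A S >]]|)%N.
  apply/card_gt0P; exists set0; rewrite inE; apply/asboolP => v v0 _.
  by apply/colP => i; rewrite mxE v0 ?inE.
have [a /asboolP freea qE] := eq_bigmax_cond (fun S : {set 'I_n} => #|S|) free0.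
by exists a.
Qed.

Lemma rfree_card_qrank m n (A : 'M[H]_(m, n)) (a : {set 'I_n}) :
  rfree_cols A a -> (#|a| <= qrank A)%N.
Proof.
move=> freea; apply: (leq_bigmax_cond (F := fun S : {set 'I_n} => #|S|)).
exact/asboolP.
Qed.

Lemma char_coef_gt_qrank n (M : 'M[H]_n) s :
  qhermitian M -> (qrank M < s)%N -> char_coef M s = 0.
Proof.
move=> hM rs; apply: big1 => a /eqP as_; apply: mindet_not_rfree => // /rfree_card_qrank.
by rewrite as_ leqNgt rs.
Qed.

(** Descending induction on [s], with [t] bounding [n - s]. Beyond the rank the recursion reads
    [M R_s = - R_(s+1)], so [M M R_s = 0], and a Hermitian [M] has the same kernel as its square. *)
Lemma mul_adj_coef_qrank n (M : 'M[H]_n) :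
  qhermitian M -> M *m adj_coef M (qrank M) = 0.
Proof.
move=> hM; suff H0 t s : (qrank M <= s)%N -> (n <= s + t)%N -> M *m adj_coef M s = 0.
  by apply: (H0 n); rewrite ?leq_addl.
elim: t s => [|t IHt] s rs; first by rewrite addn0 => ns; rewrite adj_coef_out ?mulmx0.
move=> nst; apply: hermitian_ker => //; rewrite -mulmxA.
have := adj_coef_rec hM s; rewrite char_coef_gt_qrank // raddf0 => /eqP.
rewrite addr_eq0 => /eqP ->; rewrite mulmxN IHt ?oppr0 //; first exact: leqW.
by rewrite addSnnS.
Qed.

Lemma char_coef_real n (M : 'M[H]_n) s :
  qhermitian M -> quat_of_real (qr (char_coef M s)) = char_coef M s.
Proof.
move=> hM; rewrite /char_coef raddf_sum [LHS]raddf_sum.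
by apply: eq_bigr => a _; apply: mindet_real.
Qed.

(* If det M vanished, then running the recursion downwards all the
   coefficients would vanish, including the leading one. *)
Lemma char_coef_injective n (M : 'M[H]_n) : qhermitian M ->
  (forall X : 'M[H]_n, M *m X = 0 -> X = 0) -> qr (char_coef M n) != 0.
Proof.
move=> hM injM; apply/eqP => dn0.
suff H0 t : (t <= n)%N -> char_coef M (n - t) = 0 /\ adj_coef M (n - t) = 0.
  have [] := H0 n (leqnn n); rewrite subnn char_coef0 => /eqP.
  by rewrite oner_eq0.
elim: t => [_|t IHt tn].
  by rewrite subn0 adj_coef_out // -char_coef_real // dn0 raddf0.
have [] := IHt (ltnW tn); have -> : (n - t = (n - t.+1).+1)%N by rewrite -subSn.
set s := (n - t.+1)%N => ds as0.
have adj0 : adj_coef M s = 0.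
  by apply: injM; have := adj_coef_rec hM s; rewrite ds as0 addr0 raddf0.
(* Comparing traces gives [(n - s) d_s = 0], where [s < n]. *)
split=> //; have := sum_diag_adj_coef M s.
rewrite adj0 big1 => [|j _]; last by rewrite mxE.
rewrite -char_coef_real // => /(congr1 (@qr R)); rewrite raddfMn /= => /esym/eqP.
by rewrite mulrn_eq0 subn_eq0 leqNgt ltn_subrL (leq_trans _ tn) //= => /eqP->; rewrite raddf0.
Qed.

(** Minors on free sets are positive and all others vanish; some free set has the size of the
    rank. *)
Lemma char_coef_gram n (A : 'M[H]_n) :
  0 < qr (char_coef (ctransmx A *m A) (qrank A)).
Proof.
have hM : qhermitian (ctransmx A *m A) by rewrite /qhermitian ctransmxM ctransmxK.
have [a freea <-] := qrank_free A.
rewrite /char_coef raddf_sum (bigD1 a) //=.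
rewrite ltr_pwDl ?mindet_gram_gt0 // sumr_ge0 // => b _.
have [freeb|nfreeb] := pselect (rfree_cols A b); first exact/ltW/mindet_gram_gt0.
rewrite mindet_not_rfree ?raddf0 // => freeM; apply: nfreeb => v vb Av; apply: freeM => //.
by rewrite -mulmxA Av mulmx0.
Qed.

(** Columns free for [A] remain free for [A ^+ 2], because the kernels agree. *)
Lemma mxind_hermitian n (A : 'M[H]_n) : qhermitian A -> (mxind A <= 1)%N.
Proof.
move=> hA; rewrite /mxind; case: ex_minnP => k _; apply.
rewrite eqn_leq qrank_exprS /=; have [a freea <-] := qrank_free (A ^+ 1).
apply: rfree_card_qrank => v va A2v; apply: freea => //.
by apply: hermitian_ker => //; rewrite -[RHS]A2v.
Qed.

Lemma qrank1 n : qrank (1%:M : 'M[H]_n) = n.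
Proof.
apply/eqP; rewrite eqn_leq; apply/andP; split.
  by have [a _ <-] := qrank_free (1%:M : 'M[H]_n); rewrite -[leqRHS]card_ord max_card.
rewrite -[leqLHS]card_ord -cardsT; apply: rfree_card_qrank => v _.
by rewrite mul1mx.
Qed.

Lemma qrank_full_inj n (A : 'M[H]_n) p (X : 'M[H]_(n, p)) :
  qrank A = n -> A *m X = 0 -> X = 0.
Proof.
move=> rA AX; have [a freea] := qrank_free A; rewrite rA => ca.
have aT : a = [set: 'I_n].
  by apply/eqP; rewrite eqEcard subsetT cardsT card_ord ca leqnn.
apply/matrixP => i j; have /(congr1 (fun v : 'cV[H]_n => v i 0)) : col j X = 0.
  apply: freea => [l|]; first by rewrite aT inE.
  by rewrite -col_mul AX col0.
by rewrite !mxE.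
Qed.

(** * The Drazin inverse from the adjugate coefficients *)

Lemma real_scalar_mxC m n (c : R) (X : 'M[H]_(m, n)) :
  (quat_of_real c)%:M *m X = X *m (quat_of_real c)%:M.
Proof.
apply/matrixP => i j; rewrite mul_scalar_mx !mxE (bigD1 j) //= big1 => [|l /negPf lj].
  by rewrite addr0 mxE eqxx mulr1n quat_of_realC.
by rewrite mxE lj mulr0n mulr0.
Qed.

(** By the recursion, [adj_coef M s] is a polynomial in [M] with real, hence central,
    coefficients. *)
Lemma adj_coef_comm n (M Y : 'M[H]_n) s : qhermitian M ->
  Y *m M = M *m Y -> adj_coef M s *m Y = Y *m adj_coef M s.
Proof.
move=> hM YM; elim: s => [|s IHs]; first by rewrite adj_coef0 mul1mx mulmx1.
have := adj_coef_rec hM s => /eqP; rewrite addrC eq_sym -subr_eq => /eqP <-.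
rewrite mulmxBl mulmxBr -char_coef_real // real_scalar_mxC; congr (_ - _).
by rewrite -mulmxA IHs !mulmxA YM.
Qed.

Lemma drazinE n (A : 'M[H]_n) s :
    let k := mxind A in let M := A ^+ k.+1 in
    qhermitian A -> qr (char_coef M s.+1) != 0 ->
    A ^+ k *m adj_coef M s.+1 = 0 ->
  drazin A = (quat_of_real (qr (char_coef M s.+1))^-1)%:M *m (A ^+ k *m adj_coef M s).
Proof.
move=> k M hA d0 Aadj.
set e := (X in X%:M *m _); set X := _ *m (_ *m _).
have hM : qhermitian M := qhermitianX _ hA.
have powC : A *m A ^+ k = A ^+ k *m A by exact: (commrX k (erefl (A * A))).
have AM : A *m M = M *m A by exact: (commrX k.+1 (erefl (A * A))).
have AkM : A ^+ k *m M = M *m A ^+ k.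
  by rewrite -[LHS]/(A ^+ k * A ^+ k.+1) -[RHS]/(A ^+ k.+1 * A ^+ k) -!exprD addnC.
have eC m p (Y : 'M[H]_(m, p)) : e%:M *m Y = Y *m e%:M := real_scalar_mxC _ Y.
have AX : A *m X = X *m A.
  by rewrite /X mulmxA -eC -!mulmxA (adj_coef_comm _ hM AM) (mulmxA A) powC !mulmxA.
(* [A *m X] differs from 1 by a multiple of [adj_coef M s.+1], which [A ^+ k] annihilates; the first
   two Drazin equations follow from this. *)
have MX : A *m X = 1%:M - e%:M *m adj_coef M s.+1.
  rewrite /X mulmxA -eC -mulmxA (mulmxA A) -[A *m A ^+ k]/(A * A ^+ k) -exprS -/M.
  have -> : M *m adj_coef M s = (char_coef M s.+1)%:M - adj_coef M s.+1.
    by apply/eqP; rewrite -(adj_coef_rec hM) addrK.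
  rewrite mulmxBr -scalar_mxM /e -{2}[char_coef _ _]char_coef_real //.
  by rewrite -rmorphM /= mulVf // rmorph1.
have drX : is_drazin A X.
  split; last by [].
    rewrite exprSr -[_ * _]/(_ *m _) -mulmxA MX mulmxBr mulmx1 mulmxA -eC -mulmxA Aadj.
    by rewrite mulmx0 subr0.
  rewrite -AX MX mulmxBl mul1mx -mulmxA /X (mulmxA (adj_coef M s.+1)) -eC.
  rewrite -(mulmxA e%:M) (mulmxA (adj_coef M s.+1)) (adj_coef_comm _ hM AkM) Aadj.
  by rewrite mul0mx !mulmx0 subr0.
apply: classical_sets.xget_unique => // Y [] Y1 Y2 Y3; case: drX => X1 X2 X3.
exact: (drazin_unique Y1 Y2 Y3 X1 X2 X3).
Qed.

End HermitianRank.

Theorem theorem4p2 (R : realType) (m n k r : nat)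
  (A : 'M[quat R]_n) (B : 'M[quat R]_(m, n))
  (hA : qhermitian A)
  (hk : mxind A = k)
  (hr1 : qrank (A ^+ k.+1) = r) (hr0 : qrank (A ^+ k) = r)
  (r_gt0 : (1 <= r)%N) (r_le : (r <= n)%N)
  (i : 'I_m) (j : 'I_n) :
  (B *m drazin A) i j =
  (\sum_(a : {set 'I_n} | (#|a| == r) && (j \in a))
      rdet a j (row_repl (A ^+ k.+1) j (row i (B *m A ^+ k))))
  / quat_of_real (\sum_(a : {set 'I_n} | #|a| == r) hdet a (A ^+ k.+1)).
Proof.
have k_le1 := mxind_hermitian hA; rewrite hk in k_le1.
have hM := qhermitianX k.+1 hA.
case: r r_gt0 r_le hr1 hr0 => // s _ s_lt hr1 hr0.
(* For [k = 0] the rank is that of the identity, so [A] is injective; for [k = 1] this is the kernel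
   of a Hermitian square. *)
have kerA p (X : 'M[quat R]_(n, p)) : A ^+ k.+1 *m X = 0 -> A ^+ k *m X = 0.
  case: k k_le1 hk hr1 hr0 hM => [|[|//]] _ hk hr1 hr0 hM.
    by move=> AX; rewrite (qrank_full_inj _ AX) ?mulmx0 // hr1 -hr0 qrank1.
  exact: hermitian_ker.
(* For [k = 0], [r = n] and the coefficient is the full determinant; for [k = 1], [A ^+ 2] is the
   Gram matrix of [A]. *)
have d_neq0 : qr (char_coef (A ^+ k.+1) s.+1) != 0.
  case: k k_le1 hk hr1 hr0 hM kerA => [|[|//]] _ hk hr1 hr0 hM kerA.
    have sn : s.+1 = n by rewrite -hr0 qrank1.
    rewrite sn; apply: char_coef_injective => // X.
    by apply: qrank_full_inj; rewrite hr1.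
  have := char_coef_gram A; rewrite hA -[qrank A]/(qrank (A ^+ 1)) hr0.
  by move/lt0r_neq0.
have Aadj : A ^+ k *m adj_coef (A ^+ k.+1) s.+1 = 0.
  by apply: kerA; rewrite -hr1 mul_adj_coef_qrank.
have := drazinE (s := s) hA; rewrite hk => -> //.
(* The inverse of the denominator is real, so it can be moved to the right of the numerator. *)
rewrite mulmxA -real_scalar_mxC -mulmxA mul_scalar_mx mxE quat_of_realC; congr (_ * _).
  by rewrite sum_rdet_row_repl -row_mul mulmxA [RHS]mxE.
rewrite fmorphV /= char_coef_real // raddf_sum; congr (_^-1).
by apply: eq_bigr => a /eqP as_; rewrite /= hdetE // -card_gt0 as_.
Qed.
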